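(* Soft-threshold search is correct: when an arc $(v,w)$ with $v>w$ is added to an acyclic graph with topological order $<$, the soft-threshold search reports a cycle (returns a non-null arc) if and only if the addition of $(v,w)$ creates a cycle, and if it returns null then after the reordering step the resulting order is a topological order of the graph including $(v,w)$. This holds for every choice of the new thresholds $s$ and of the vertices $u,z$ in each iteration.
   Context: Comparisons use the order before the addition; arcs of the graph other than $(v,w)$ are used. Each vertex has a list of outgoing and a list of incoming arcs. Soft-threshold search: initialize $F=\{w\}$, $B=\{v\}$, $\mathit{out}(w)=$ first outgoing arc of $w$, $\mathit{in}(v)=$ first incoming arc of $v$ (null if none), $s=v$; $F_A=\{w\}$ if $\mathit{out}(w)\ne$ null else $\{\}$; $B_A=\{v\}$ if $\mathit{in}(v)\ne$ null else $\{\}$; $F_P=B_P=\{\}$. While $F_A\ne\{\}$ and $B_A\ne\{\}$: choose any $u\in F_A$, $z\in B_A$. If $u<z$: let $(u,x)=\mathit{out}(u)$, $(y,z)=\mathit{in}(z)$; advance $\mathit{out}(u)$, $\mathit{in}(z)$ to the next arcs on their lists (null if none); remove $u$ from $F_A$ if $\mathit{out}(u)$ is null and $z$ from $B_A$ if $\mathit{in}(z)$ is null; if $x\in B$ return $(u,x)$; else if $y\in F$ return $(y,z)$; if $x\notin F$, add $x$ to $F$, set $\mathit{out}(x)$ to its first outgoing arc and add $x$ to $F_A$ if non-null; if $y\notin B$, add $y$ to $B$, set $\mathit{in}(y)$ to its first incoming arc and add $y$ to $B_A$ if non-null. Otherwise: if $u>s$ move $u$ from $F_A$ to $F_P$; if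 $z<s$ move $z$ from $B_A$ to $B_P$. Then if $F_A=\{\}$: set $B_P=\{\}$, remove $s$ from $B_A$, and if $F_P\ne\{\}$ choose a new $s\in F_P$ and move all $x\in F_P$ with $x\le s$ to $F_A$. If $B_A=\{\}$: set $F_P=\{\}$, remove $s$ from $F_A$, and if $B_P\ne\{\}$ choose a new $s\in B_P$ and move all $x\in B_P$ with $x\ge s$ to $B_A$. When the loop ends return null. Reordering after null: let $t=\min(\{v\}\cup\{x\in F:\mathit{out}(x)\ne\text{null}\})$, $F_<=\{x\in F:x<t\}$, $B_>=\{y\in B:y>t\}$; if $t=v$ move all of $F_<$ to just after $t$; otherwise move all of $F_<$ to just before $t$ and all of $B_>$ to just before all of $F_<$; order vertices within $F_<$ and within $B_>$ topologically with respect to their induced subgraphs.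
   Formalization: As described, the search may loop forever when a cycle is created (w<x<v, arcs (w,x),(x,v)). So the ''if and only if'' is proved for runs that return; a run that never returns is shown to repeat one ineffective iteration forever, only when adding (v,w) creates a cycle. *)

(* Defs.v *)
From HB Require Import structures.
From mathcomp Require Import all_boot.
Set Implicit Arguments.
Unset Strict Implicit.
Unset Printing Implicit Defensive.

(* A directed graph on the finite type V is given by the sequence of its arcs
   (multiple arcs are allowed).  A total order on V is given by a sequence
   listing every vertex exactly once, smallest first. *)

Section Graph.
Variable V : finType.
Implicit Types (E : seq (V * V)) (S : {set V}) (ord s L : seq V) (x y t : V).

Definition arc_rel E : rel V := fun x y => (x, y) \in E.

Definition has_cycle E : Prop := exists2 c, c != [::] & cycle (arc_rel E) c.

Definition before ord x y : bool := index x ord < index y ord.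

(* L lists S in topological order for the subgraph of E induced by S. *)
Definition topological_on E S L : Prop :=
  perm_eq L (enum S) /\
  forall x y, (x, y) \in E -> x \in S -> y \in S -> before L x y.

Definition topological_order E ord : Prop := topological_on E [set: V] ord.

(* The lists of outgoing and incoming arcs, in arbitrary order. *)
Definition incidence_lists E (outs ins : V -> seq (V * V)) : Prop :=
  (forall x, perm_eq (outs x) [seq a <- E | a.1 == x]) /\
  (forall x, perm_eq (ins x) [seq a <- E | a.2 == x]).

Definition insert_before t L s : seq V :=
  take (index t s) s ++ L ++ drop (index t s) s.

Definition insert_after t L s : seq V :=
  take (index t s).+1 s ++ L ++ drop (index t s).+1 s.

End Graph.

(* The pointers out(x) and in(x) are represented by the remaining suffixes of
   the corresponding arc lists: the arc pointed at is the head of the suffix,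
   and null is [::].  Only out(x) for x in F and in(x) for x in B matter. *)
Record state (V : finType) := State {
  sF : {set V};
  sB : {set V};
  out : {ffun V -> seq (V * V)};
  inn : {ffun V -> seq (V * V)};
  thr : V;                        (* the soft threshold s *)
  FA : {set V};
  FP : {set V};
  BA : {set V};
  BP : {set V}
}.

Section Search.
Variable V : finType.
Variables (outs ins : V -> seq (V * V)) (ord : seq V) (v w : V).
Implicit Types (st : state V) (u z : V) (r : option (V * V)).

Definition upd (f : {ffun V -> seq (V * V)}) x l :=
  [ffun a => if a == x then l else f a].

Definition init : state V := {|
  sF := [set w];
  sB := [set v];
  out := [ffun x => if x == w then outs w else [::]];
  inn := [ffun x => if x == v then ins v else [::]];
  thr := v;
  FA := if outs w != [::] then [set w] else set0;
  FP := set0;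
  BA := if ins v != [::] then [set v] else set0;
  BP := set0
|}.

(* The arcs out(u) and in(z); the default of head is never used, because
   active vertices have non-null pointers. *)
Definition out_arc st u : V * V := head (u, u) (out st u).
Definition in_arc st z : V * V := head (z, z) (inn st z).

Definition hit st u z : option (V * V) :=
  if (out_arc st u).2 \in sB st then Some (out_arc st u)
  else if (in_arc st z).1 \in sF st then Some (in_arc st z)
  else None.

Definition advance st u z : state V := {|
  sF := sF st;
  sB := sB st;
  out := upd (out st) u (behead (out st u));
  inn := upd (inn st) z (behead (inn st z));
  thr := thr st;
  FA := if behead (out st u) == [::] then FA st :\ u else FA st;
  FP := FP st;
  BA := if behead (inn st z) == [::] then BA st :\ z else BA st;
  BP := BP st
|}.

Definition visit_forward x st : state V :=
  if x \in sF st then st else {|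
    sF := x |: sF st;
    sB := sB st;
    out := upd (out st) x (outs x);
    inn := inn st;
    thr := thr st;
    FA := if outs x != [::] then x |: FA st else FA st;
    FP := FP st;
    BA := BA st;
    BP := BP st
  |}.

Definition visit_backward y st : state V :=
  if y \in sB st then st else {|
    sF := sF st;
    sB := y |: sB st;
    out := out st;
    inn := upd (inn st) y (ins y);
    thr := thr st;
    FA := FA st;
    FP := FP st;
    BA := if ins y != [::] then y |: BA st else BA st;
    BP := BP st
  |}.

Definition search_step st u z : state V :=
  visit_backward (in_arc st z).1
    (visit_forward (out_arc st u).2 (advance st u z)).

Definition pause st u z : state V := {|
  sF := sF st;
  sB := sB st;
  out := out st;
  inn := inn st;
  thr := thr st;
  FA := if before ord (thr st) u then FA st :\ u else FA st;
  FP := if before ord (thr st) u then u |: FP st else FP st;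
  BA := if before ord z (thr st) then BA st :\ z else BA st;
  BP := if before ord z (thr st) then z |: BP st else BP st
|}.

Inductive refill_forward st : state V -> Prop :=
| RefillF_skip : FA st != set0 -> refill_forward st st
| RefillF_none : FA st = set0 -> FP st = set0 ->
    refill_forward st
      (State (sF st) (sB st) (out st) (inn st) (thr st)
             (FA st) (FP st) (BA st :\ thr st) set0)
| RefillF_new s : FA st = set0 -> s \in FP st ->
    refill_forward st
      (State (sF st) (sB st) (out st) (inn st) s
             [set x in FP st | ~~ before ord s x]
             [set x in FP st | before ord s x]
             (BA st :\ thr st) set0).

Inductive refill_backward st : state V -> Prop :=
| RefillB_skip : BA st != set0 -> refill_backward st st
| RefillB_none : BA st = set0 -> BP st = set0 ->
    refill_backward st
      (State (sF st) (sB st) (out st) (inn st) (thr st)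
             (FA st :\ thr st) set0 (BA st) (BP st))
| RefillB_new s : BA st = set0 -> s \in BP st ->
    refill_backward st
      (State (sF st) (sB st) (out st) (inn st) s
             (FA st :\ thr st) set0
             [set x in BP st | ~~ before ord x s]
             [set x in BP st | before ord x s]).

Inductive examine st u z : state V -> Prop :=
| Examine_search : before ord u z -> hit st u z = None ->
    examine st u z (search_step st u z)
| Examine_pause : ~~ before ord u z -> examine st u z (pause st u z).

(* One iteration of the loop that does not return.  The refilling takes place
   after a search step as well as after a pause, and the test on BA uses the
   state left by the test on FA. *)
Inductive iteration st : state V -> Prop :=
| Iteration u z st1 st2 st3 :
    u \in FA st -> z \in BA st -> examine st u z st1 ->
    refill_forward st1 st2 -> refill_backward st2 st3 -> iteration st st3.

Inductive reachable : state V -> Prop :=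
| Reachable_init : reachable init
| Reachable_iteration st st' :
    reachable st -> iteration st st' -> reachable st'.

(* The search may return r (None is null) when it is in state st. *)
Inductive returns st : option (V * V) -> Prop :=
| Returns_arc u z a : u \in FA st -> z \in BA st -> before ord u z ->
    hit st u z = Some a -> returns st (Some a)
| Returns_null : FA st = set0 \/ BA st = set0 -> returns st None.

(* Infinite runs exist: for w < x < v and the arcs (w, x) and (x, v), the first
   iteration puts x both in F and in B without reporting a cycle; the second
   one makes x the new threshold, and then u = z = s = x is the only choice
   and leaves the state unchanged. *)
Definition infinite_run (run : nat -> state V) : Prop :=
  run 0 = init /\ forall k, iteration (run k) (run k.+1).

(* The search is never stuck, so that a run which is not infinite ends by
   returning. *)
Lemma search_progress st :
  (exists r, returns st r) \/ (exists st', iteration st st').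
Proof.
have [F0|/set0Pn[u Fu]] := eqVneq (FA st) set0.
  by left; exists None; apply: Returns_null; left.
have [B0|/set0Pn[z Bz]] := eqVneq (BA st) set0.
  by left; exists None; apply: Returns_null; right.
have refF st1 : exists st2, refill_forward st1 st2.
  have [F0|F0] := eqVneq (FA st1) set0; last by exists st1; constructor 1.
  have [P0|/set0Pn[s Ps]] := eqVneq (FP st1) set0.
    by eexists; apply: RefillF_none.
  by eexists; apply: RefillF_new Ps.
have refB st1 : exists st2, refill_backward st1 st2.
  have [B0|B0] := eqVneq (BA st1) set0; last by exists st1; constructor 1.
  have [P0|/set0Pn[s Ps]] := eqVneq (BP st1) set0.
    by eexists; apply: RefillB_none.
  by eexists; apply: RefillB_new Ps.
suff [[a [uz ha]]|[st1 ex1]] : (exists a, before ord u z /\ hit st u z = Some a)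
    \/ exists st1, examine st u z st1.
- by left; exists (Some a); apply: Returns_arc ha.
- have [st2 r2] := refF st1; have [st3 r3] := refB st2.
  by right; exists st3; apply: Iteration ex1 r2 r3.
case uz: (before ord u z); last by right; eexists; apply: Examine_pause; rewrite uz.
by case ha: (hit st u z) => [a|]; [left; exists a | right; eexists; apply: Examine_search].
Qed.

End Search.

Section Reorder.
Variables (V : finType) (E : seq (V * V)) (ord : seq V) (v : V) (st : state V).

(* The minimum, for ord, of v and the forward vertices with non-null out. *)
Definition reorder_pivot : V :=
  head v [seq x <- ord | (x == v) || (x \in sF st) && (out st x != [::])].

Definition F_below : {set V} := [set x in sF st | before ord x reorder_pivot].
Definition B_above : {set V} := [set y in sB st | before ord reorder_pivot y].

Inductive reorder : seq V -> Prop :=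
| Reorder_eq LF :
    reorder_pivot = v -> topological_on E F_below LF ->
    reorder (insert_after reorder_pivot LF [seq x <- ord | x \notin F_below])
| Reorder_neq LF LB :
    reorder_pivot <> v ->
    topological_on E F_below LF -> topological_on E B_above LB ->
    reorder (insert_before reorder_pivot (LB ++ LF)
               [seq x <- ord | (x \notin F_below) && (x \notin B_above)]).

End Reorder.

(* Main.v *)
(** Call a vertex of F (of B) open if it still has untraversed outgoing
(incoming) arcs. An open vertex is discarded only when the soft threshold
separates it from all active and passive vertices of the other search, so that
for x open in F and y open in B, either y < x or neither has been discarded. When
the search returns null, one side has nothing left but discarded vertices, so
that y < x for all such x and y. A path from w to v would then contain an arc
whose tail is exhausted in F and whose head is exhausted in B; but an arc
traversed from one end is reported when it is about to be traversed from the
other. Hence no cycle is created, and checking the arcs one by one shows that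
the reordering is topological.

A run terminates because every iteration decreases a lexicographic measure,
except a pause with u = z = s, which puts s on a path from w to v. *)

Require Import Defs.
From mathcomp Require Import all_boot zify.
From Stdlib Require Import Classical_Prop.
Set Implicit Arguments.
Unset Strict Implicit.
Unset Printing Implicit Defensive.

(* One side of the search: [lst] and [far] are [outs] and [snd] for the forward
   side, [ins] and [fst] for the backward one. [S] is the set of visited
   vertices, [A] and [P] those of active and passive ones. *)
Section Side.
Variables (V : finType) (lst : V -> seq (V * V)) (far : V * V -> V).
Implicit Types (S A P : {set V}) (ptr : {ffun V -> seq (V * V)}) (u x p : V).

(** [side_open] has no converse: an open vertex of [S] in neither [A] nor [P] has been discarded. By
    [side_closed], once the pointer of a visited vertex is null, all its neighbours on this side are
    visited. *)
Record side_inv S ptr A P : Prop := SideInv {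
  side_open : forall x, (x \in A) || (x \in P) -> (x \in S) && (ptr x != [::]);
  side_disjoint : forall x, x \in A -> x \in P -> False;
  side_ptr : forall x, x \in S -> {subset ptr x <= lst x};
  side_closed : forall x e, x \in S -> e \in lst x -> e \in ptr x \/ far e \in S
}.

Lemma side_inv_sub S ptr A P A' P' :
  side_inv S ptr A P ->
  (forall x, (x \in A') || (x \in P') -> (x \in A) || (x \in P)) ->
  (forall x, x \in A' -> x \in P' -> False) -> side_inv S ptr A' P'.
Proof.
by case=> op _ sub cl s1 s2; split=> // x /s1 /op.
Qed.

(** Closed form of one side of a search step, shared by both directions; [search_stepE] makes the
    link. *)
Definition next_ptr S ptr u x :=
  let q := upd ptr u (behead (ptr u)) in
  if x \in S then q else upd q x (lst x).

Definition next_active S ptr A u x :=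
  let A1 := if behead (ptr u) == [::] then A :\ u else A in
  if x \in S then A1 else if lst x != [::] then x |: A1 else A1.

Lemma next_ptrE S ptr u x p :
  next_ptr S ptr u x p =
    if (p == x) && (x \notin S) then lst x
    else if p == u then behead (ptr u) else ptr p.
Proof.
rewrite /next_ptr /upd; case: ifP => xS; rewrite !ffunE ?andbF //.
by rewrite andbT.
Qed.

Lemma mem_next_active S ptr A P u x p : side_inv S ptr A P ->
  (p \in next_active S ptr A u x) =
    if (p == x) && (x \notin S) then lst x != [::]
    else (p \in A) && ((p != u) || (behead (ptr u) != [::])).
Proof.
move=> I.
have A1E : (p \in (if behead (ptr u) == [::] then A :\ u else A)) =
    (p \in A) && ((p != u) || (behead (ptr u) != [::])).
  by case: ifP => _; rewrite ?in_setD1 /= ?orbF ?orbT ?andbT // andbC.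
rewrite /next_active; case: ifP => xS; first by rewrite andbF.
rewrite andbT; have [->|px] := eqVneq p x.
  case: ifP => _; first by rewrite setU11.
  have xA : x \notin A.
    apply/negP => xA; move: (side_open I (x := x)).
    by rewrite xA xS => /(_ isT).
  by case: ifP => _; rewrite ?in_setD1 (negPf xA) ?andbF.
by case: ifP => _; rewrite ?in_setU1 ?(negPf px).
Qed.

(** The only arc that leaves a pointer is the head of [ptr u], whose far end [x] enters the visited
    set; a fresh [x] starts with its full list. *)
Lemma side_inv_next S ptr A P u : side_inv S ptr A P -> u \in A ->
  let x := far (head (u, u) (ptr u)) in
  side_inv (x |: S) (next_ptr S ptr u x) (next_active S ptr A u x) P.
Proof.
move=> I uA x; have [op dj sp cl] := I.
have /andP[uS] : (u \in S) && (ptr u != [::]) by apply: op; rewrite uA.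
case Eu: (ptr u) => [//|e l] _.
have xE : x = far e by rewrite /x Eu.
have xnP q : q \in P -> (q == x) && (x \notin S) = false.
  move=> qP; apply/negP => /andP[/eqP qx]; rewrite -qx.
  by have /andP[->] : (q \in S) && (ptr q != [::]) by apply: op; rewrite qP orbT.
split=> [q|q|q|q e'].
- rewrite (mem_next_active _ _ _ I) next_ptrE in_setU1.
  case: ifP => [/andP[/eqP-> xS]|qx].
    rewrite eqxx /=; case/orP => // xP; have := xnP x xP.
    by rewrite eqxx xS.
  case/orP => [/andP[qA]|qP].
    have /andP[qS qo] : (q \in S) && (ptr q != [::]) by apply: op; rewrite qA.
    by rewrite qS orbT; case: (q =P u) => [_|_].
  have /andP[qS qo] : (q \in S) && (ptr q != [::]) by apply: op; rewrite qP orbT.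
  rewrite qS orbT; case: (q =P u) => // qu; case: (dj q) => //; by rewrite qu.
- rewrite (mem_next_active _ _ _ I); case: ifP => [qx _ /xnP|_ /andP[qA _]].
    by rewrite qx.
  exact: dj.
- rewrite next_ptrE in_setU1; case: ifP => [/andP[/eqP-> _] _ a //|qx qS a].
  have {}qS : q \in S by case/predU1P: qS qx => // ->; rewrite eqxx /= => /negbFE.
  case: eqP => [qu|_]; last exact: sp.
  by rewrite qu => /mem_behead; apply: sp.
- rewrite next_ptrE !in_setU1; case: ifP => [/andP[/eqP-> _]|qx qS]; first by left.
  have {}qS : q \in S by case/predU1P: qS qx => // ->; rewrite eqxx /= => /negbFE.
  move=> /(cl _ _ qS) [|->]; last by right; rewrite orbT.
  case: eqP => [->|_]; last by left.
  rewrite Eu inE => /predU1P[->|->]; last by left.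
  by right; rewrite xE eqxx.
Qed.

(** A search step discards no open vertex: [u] leaves [A] only when its pointer becomes null. This
    serves to preserve [inv_sep]. *)
Lemma next_open S ptr A P u x p : side_inv S ptr A P ->
  p \in x |: S -> next_ptr S ptr u x p != [::] ->
  (p = x /\ p \in next_active S ptr A u x) \/
  [/\ p \in S, ptr p != [::] &
      ((p \in next_active S ptr A u x) || (p \in P)) = ((p \in A) || (p \in P))].
Proof.
move=> I; rewrite next_ptrE (mem_next_active _ _ _ I) in_setU1.
case: ifP => [/andP[/eqP-> _]|px pS po]; first by left.
right; have pS' : p \in S.
  by case/predU1P: pS px => // ->; rewrite eqxx /= => /negbFE.
move: po; case: (p =P u) => [pu|_] po; split=> //.
- by rewrite pu; case: (ptr u) po.
- by rewrite po andbT.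
- by rewrite andbT.
Qed.

Lemma next_sub S ptr A P u x p a : side_inv S ptr A P -> p \in S ->
  a \in ptr p -> a \in next_ptr S ptr u x p \/ a = head (u, u) (ptr u) /\ p = u.
Proof.
move=> I pS ap; rewrite next_ptrE; case: ifP => [/andP[/eqP<-]|_].
  by rewrite pS.
case: eqP => [pu|_]; last by left.
move: ap; rewrite pu; case: (ptr u) => //= b l; rewrite inE.
by case/predU1P=> [->|]; [right|left].
Qed.

End Side.

(** * Inserting a block of vertices into an order *)

Section Insertion.
Variable V : finType.
Implicit Types (s L : seq V) (x y t : V).

Lemma before_filter (p : pred V) s x y :
  p x -> p y -> before (filter p s) x y = before s x y.
Proof.
move=> px py; rewrite /before; elim: s => //= a s IHs.
case: ifP => [_|pa] /=.
  by case: (a == x); case: (a == y); rewrite // ltnS.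
have /negPf -> : a != x by apply: contraFneq pa => ->.
by have /negPf -> : a != y by apply: contraFneq pa => ->.
Qed.

Lemma before_cat_l s L x y : x \in s -> y \in s -> before (s ++ L) x y = before s x y.
Proof. by rewrite /before !index_cat => -> ->. Qed.

Lemma before_cat_r s L x y :
  x \notin s -> y \notin s -> before (s ++ L) x y = before L x y.
Proof. by rewrite /before !index_cat => /negPf-> /negPf->; rewrite ltn_add2l. Qed.

Lemma before_cat_lr s L x y : x \in s -> y \notin s -> before (s ++ L) x y.
Proof.
rewrite /before !index_cat => xs /negPf->; rewrite xs.
by apply: leq_trans (leq_addr _ _); rewrite index_mem.
Qed.

Lemma index_insert k L s x : k <= size s -> x \in s -> x \notin L ->
  index x (take k s ++ L ++ drop k s) =
    if index x s < k then index x s else index x s + size L.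
Proof.
move=> ks xs /negPf xL; rewrite !index_cat xL in_take // size_takel //.
have : index x (take k s ++ drop k s) = index x s by rewrite cat_take_drop.
rewrite index_cat in_take // size_takel //; case: ifP => // _ <-.
by rewrite [size L + _]addnC addnA.
Qed.

Lemma index_inserted k L s x : k <= size s -> x \notin s -> x \in L ->
  index x (take k s ++ L ++ drop k s) = k + index x L.
Proof.
move=> ks xs xL; rewrite !index_cat xL size_takel // ifN //.
by apply: contra xs; apply: mem_take.
Qed.

(** Filtering keeps the relative order of the vertices outside [L], and the block is contiguous from
    position [k] on, so each arc needs only a comparison with [k] or within one of the two lists. *)
Lemma topological_insert (E : seq (V * V)) ord k L
    (s := [seq x <- ord | x \notin L]) :
  uniq ord -> (forall x, x \in ord) -> uniq L -> k <= size s ->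
  (forall x y, (x, y) \in E ->
    if x \in L then if y \in L then before L x y else k <= index y s
    else if y \in L then index x s < k else before ord x y) ->
  topological_order E (take k s ++ L ++ drop k s).
Proof.
move=> uord mord uL ks arcs; have ms x : (x \in s) = (x \notin L).
  by rewrite mem_filter mord andbT.
split.
  rewrite perm_catCA cat_take_drop; apply: uniq_perm.
  - rewrite cat_uniq uL filter_uniq // andbT /=.
    by apply/hasPn=> x; rewrite ms.
  - exact: enum_uniq.
  - by move=> x; rewrite mem_cat ms orbN mem_enum in_setT.
move=> x y /arcs h _ _; rewrite /before; move: h.
have [xL|xL] := boolP (x \in L); have [yL|yL] := boolP (y \in L) => h.
- by rewrite !index_inserted ?ms ?negbK // ltn_add2l.
- rewrite index_inserted ?ms ?negbK // index_insert ?ms //.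
  by rewrite [index y s < k]ltnNge h /= -addnS leq_add // index_mem.
- rewrite index_insert ?ms // index_inserted ?ms ?negbK // h.
  exact: leq_trans h (leq_addr _ _).
- have := before_filter ord xL yL (p := fun x => x \notin L).
  rewrite h -/s /before => lt_xy; rewrite !index_insert ?ms //.
  by case: ifP; case: ifP; lia.
Qed.

End Insertion.

(** * Order, reachability and cycles *)

Section Correctness.
Variables (V : finType) (E : seq (V * V)) (outs ins : V -> seq (V * V)).
Variables (ord : seq V) (v w : V).
Hypothesis topE : topological_order E ord.
Hypothesis incE : incidence_lists E outs ins.
Hypothesis lt_wv : before ord w v.
Local Notation lt := (before ord).
Local Notation e := (arc_rel E).
Implicit Types (st : state V) (x y u z : V).

Lemma mem_ord x : x \in ord.
Proof. by case: topE => /perm_mem -> _; rewrite mem_enum in_setT. Qed.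

Lemma index_ord_inj x y : index x ord = index y ord -> x = y.
Proof. by apply: (index_inj v); apply: mem_ord. Qed.

Lemma before_trans y x z : lt x y -> lt y z -> lt x z.
Proof. exact: ltn_trans. Qed.

Lemma arc_lt x y : (x, y) \in E -> lt x y.
Proof. by move=> xy; case: topE => _; apply; rewrite ?in_setT. Qed.

Lemma mem_outs x a : (a \in outs x) = (a \in E) && (a.1 == x).
Proof. by case: incE => /(_ x) /perm_mem -> _; rewrite mem_filter andbC. Qed.

Lemma mem_ins x a : (a \in ins x) = (a \in E) && (a.2 == x).
Proof. by case: incE => _ /(_ x) /perm_mem ->; rewrite mem_filter andbC. Qed.

Lemma connect_le x y : connect e x y -> index x ord <= index y ord.
Proof.
case/connectP=> p; elim: p x => [|x' p IHp] x /= => [_ -> //|].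
case/andP=> /arc_lt lt_xx' /IHp /[apply]; move: lt_xx'; rewrite /before; lia.
Qed.

Lemma cycle_connect : has_cycle ((v, w) :: E) <-> connect e w v.
Proof.
split=> [[c c0 cyc]|/connectP[p pw vE]]; last first.
  exists (w :: p) => //=; rewrite rcons_path -vE {2}/arc_rel inE eqxx andbT.
  by apply: sub_path pw => x y; rewrite /arc_rel inE orbC => ->.
apply/negP => /negP nwv.
(* If [v] is not reachable from [w], then moving everything reachable from
   [w] to the end of the order makes it topological for the enlarged graph. *)
pose key x := connect e w x * (size ord) + index x ord.
have keyE x y : arc_rel ((v, w) :: E) x y -> key x < key y.
  rewrite /key /arc_rel inE => /predU1P[[-> ->]|xy].
    rewrite (negPf nwv) connect0.
    have : index v ord < size ord by rewrite index_mem mem_ord.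
    lia.
  have := arc_lt xy; rewrite /before.
  case: (boolP (connect e w x)) => wx; last by case: (connect e w y); lia.
  have -> : connect e w y by apply: connect_trans wx (connect1 xy).
  lia.
have keyP x p : path (arc_rel ((v, w) :: E)) x p -> key x <= key (last x p).
  by elim: p x => //= y p IHp x /andP[/keyE xy /IHp]; lia.
case: c c0 cyc => //= x p _; rewrite rcons_path => /andP[/keyP xp /keyE]; lia.
Qed.

(** * The loop invariant and its preservation *)

Record inv st : Prop := Inv {
  inv_fwd : side_inv outs snd (sF st) (out st) (FA st) (FP st);
  inv_bwd : side_inv ins fst (sB st) (inn st) (BA st) (BP st);
  inv_reachF : forall x, x \in sF st -> connect e w x;
  inv_reachB : forall y, y \in sB st -> connect e y v;
  inv_wF : w \in sF st;
  inv_vB : v \in sB st;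
  inv_vF : v \notin sF st;
  inv_wB : w \notin sB st;
  (* No arc is traversed in both directions. *)
  inv_meet : forall a b, (a, b) \in E -> a \in sF st -> b \in sB st ->
    (a, b) \in out st a \/ (a, b) \in inn st b;
  inv_FP : forall x, x \in FP st -> lt (thr st) x;
  inv_BP : forall y, y \in BP st -> lt y (thr st);
  (* A vertex with untraversed arcs is discarded only once it is on the far
     side of all such vertices of the opposite search. *)
  inv_sep : forall x y, x \in sF st -> y \in sB st ->
    out st x != [::] -> inn st y != [::] ->
    lt y x \/ ((x \in FA st) || (x \in FP st)) && ((y \in BA st) || (y \in BP st))
}.

Lemma neq_wv : w != v.
Proof. by apply/eqP => wv; move: lt_wv; rewrite wv /before ltnn. Qed.

Lemma inv_init : inv (init outs ins v w).
Proof.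
have nwv := neq_wv.
split=> /=; rewrite ?in_set1 ?eqxx //.
- split=> [x|x|x|x a].
  + rewrite in_set0 orbF ffunE; case: ifP => // o; rewrite ?in_set0 // in_set1.
    by move=> /eqP->; rewrite eqxx.
  + by rewrite in_set0.
  + by rewrite in_set1 ffunE => /eqP ->; rewrite eqxx.
  + by rewrite in_set1 ffunE => /eqP ->; rewrite eqxx; left.
- split=> [x|x|x|x a].
  + rewrite in_set0 orbF ffunE; case: ifP => // o; rewrite ?in_set0 // in_set1.
    by move=> /eqP->; rewrite eqxx.
  + by rewrite in_set0.
  + by rewrite in_set1 ffunE => /eqP ->; rewrite eqxx.
  + by rewrite in_set1 ffunE => /eqP ->; rewrite eqxx; left.
- by move=> x /set1P ->.
- by move=> x /set1P ->.
- by rewrite eq_sym.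
- move=> a b ab /set1P aw _; left.
  by rewrite ffunE aw eqxx mem_outs -{1}aw ab /= .
- by move=> x; rewrite in_set0.
- by move=> x; rewrite in_set0.
- move=> x y /set1P-> /set1P->; rewrite !ffunE !eqxx => -> ->.
  by rewrite !in_set1 !eqxx; right.
Qed.

(** Adding an already visited vertex to [sF] or [sB] changes nothing, so these two updates need no
    case distinction. *)
Lemma search_stepE st u z (x := (out_arc st u).2) (y := (in_arc st z).1) :
  search_step outs ins st u z =
    State (x |: sF st) (y |: sB st)
      (next_ptr outs (sF st) (out st) u x) (next_ptr ins (sB st) (inn st) z y)
      (thr st)
      (next_active outs (sF st) (out st) (FA st) u x) (FP st)
      (next_active ins (sB st) (inn st) (BA st) z y) (BP st).
Proof.
have setU1_id (a : V) (A : {set V}) : a \in A -> a |: A = A.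
  by move=> aA; apply/setUidPr; rewrite sub1set.
rewrite /search_step -/x -/y /visit_forward /next_ptr /next_active /=.
case: ifP => xF; rewrite /visit_backward /=; case: ifP => yB //=;
  by rewrite ?(setU1_id _ _ xF) ?(setU1_id _ _ yB).
Qed.

Lemma hitN st u z : hit st u z = None ->
  (out_arc st u).2 \notin sB st /\ (in_arc st z).1 \notin sF st.
Proof. by rewrite /hit; case: ifP => //; case: ifP. Qed.

Lemma out_arcP st u : inv st -> u \in FA st ->
  [/\ u \in sF st, out_arc st u \in out st u &
      out_arc st u = (u, (out_arc st u).2) /\ (u, (out_arc st u).2) \in E].
Proof.
move=> I uA; have [op _ sp _] := inv_fwd I.
have /andP[uF] : (u \in sF st) && (out st u != [::]) by rewrite op ?uA.
rewrite /out_arc; case Eo: (out st u) => [//|a l] _ /=.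
have : a \in outs u by apply: sp; rewrite ?Eo ?mem_head.
rewrite mem_outs => /andP[+ /eqP au]; rewrite -au -surjective_pairing au.
by rewrite mem_head.
Qed.

Lemma in_arcP st z : inv st -> z \in BA st ->
  [/\ z \in sB st, in_arc st z \in inn st z &
      in_arc st z = ((in_arc st z).1, z) /\ ((in_arc st z).1, z) \in E].
Proof.
move=> I zA; have [op _ sp _] := inv_bwd I.
have /andP[zB] : (z \in sB st) && (inn st z != [::]) by rewrite op ?zA.
rewrite /in_arc; case Eo: (inn st z) => [//|a l] _ /=.
have : a \in ins z by apply: sp; rewrite ?Eo ?mem_head.
rewrite mem_ins => /andP[+ /eqP az]; rewrite -az -surjective_pairing az.
by rewrite mem_head.
Qed.

Lemma inv_search st u z : inv st -> u \in FA st -> z \in BA st ->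
  hit st u z = None -> inv (search_step outs ins st u z).
Proof.
move=> I uA zA /hitN[xB yF]; rewrite search_stepE.
have [uF _ [uxE uxA]] := out_arcP I uA; have [zB _ [yzE yzA]] := in_arcP I zA.
set x := (out_arc st u).2 in xB uxE uxA *; set y := (in_arc st z).1 in yF yzE yzA *.
have IF := inv_fwd I; have IB := inv_bwd I.
have IF' := side_inv_next IF uA; have IB' := side_inv_next IB zA.
split=> //=.
- move=> p /setU1P[->|]; last exact: inv_reachF.
  by apply: connect_trans (inv_reachF I uF) (connect1 uxA).
- move=> p /setU1P[->|]; last exact: inv_reachB.
  by apply: connect_trans (connect1 yzA) (inv_reachB I zB).
- by rewrite in_setU1 (inv_wF I) orbT.
- by rewrite in_setU1 (inv_vB I) orbT.
- rewrite in_setU1 negb_or (inv_vF I) andbT.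
  by apply: contraNneq xB => <-; apply: inv_vB I.
- rewrite in_setU1 negb_or (inv_wB I) andbT.
  by apply: contraNneq yF => <-; apply: inv_wF I.
- move=> a b ab.
  have [/andP[/eqP ax xF] _ _|aF] := boolP ((a == x) && (a \notin sF st)).
    by left; rewrite next_ptrE -ax xF eqxx /= mem_outs ab /=.
  move=> aF1; have {aF1}aF : a \in sF st.
    by case/setU1P: aF1 aF => // ->; rewrite eqxx /= negbK.
  have [/andP[/eqP by_ yB] _|bB] := boolP ((b == y) && (b \notin sB st)).
    by right; rewrite next_ptrE -by_ yB eqxx /= mem_ins ab /=.
  move=> bB1; have {bB1}bB : b \in sB st.
    by case/setU1P: bB1 bB => // ->; rewrite eqxx /= negbK.
  (* An arc of [out st a] consumed by this step is [out_arc st u]; since its head [b] is in [sB st],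
     it would have been a hit. The other direction is dual. *)
  case: (inv_meet I ab aF bB) => in_ab.
    case: (next_sub u x IF aF in_ab) => [|[abE _]]; first by left.
    by move: xB; rewrite /x /out_arc -abE bB.
  case: (next_sub z y IB bB in_ab) => [|[abE _]]; first by right.
  by move: yF; rewrite /y /in_arc -abE aF.
- exact: inv_FP.
- exact: inv_BP.
(* A fresh open [x] or [y] is active and inherits the separation of [u] or [z], because [u] is
   before [x] and [y] before [z]. *)
- have lt_ux := arc_lt uxA; have lt_yz := arc_lt yzA.
  have [uo zo] : out st u != [::] /\ inn st z != [::].
    have /andP[_ ->] := side_open IF (x := u) (introT orP (or_introl uA)).
    by have /andP[_ ->] := side_open IB (x := z) (introT orP (or_introl zA)).
  move=> p q pF qB po qo.
  case: (next_open IF pF po) => [[-> ->]|[pF' po' ->]];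
  case: (next_open IB qB qo) => [[-> ->]|[qB' qo' ->]].
  + by right.
  + case: (inv_sep I uF qB' uo qo') => [lt_qu|/andP[_ ->]]; last by right.
    by left; apply: before_trans lt_qu lt_ux.
  + case: (inv_sep I pF' zB po' zo) => [lt_zp|/andP[-> _]]; last by right.
    by left; apply: before_trans lt_yz lt_zp.
  + exact: inv_sep.
Qed.

(** Pausing preserves the union of active and passive vertices on each side, which is all that
    [inv_sep] sees of these sets. *)
Lemma inv_pause st u z : inv st -> u \in FA st -> z \in BA st ->
  inv (pause ord st u z).
Proof.
move=> I uA zA.
have live (A P : {set V}) (a : V) (b : bool) x : a \in A ->
    (x \in if b then A :\ a else A) || (x \in if b then a |: P else P) =
    (x \in A) || (x \in P).
  case: b => // aA; rewrite in_setD1 in_setU1.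
  by have [->|] := eqVneq x a; rewrite ?aA.
have disj (A P : {set V}) (a : V) (b : bool) x : (x \in A -> x \in P -> False) ->
    x \in (if b then A :\ a else A) -> x \in (if b then a |: P else P) -> False.
  case: b => // AP; rewrite in_setD1 in_setU1.
  by have [|_ /= ] := eqVneq x a.
split=> /=; try by case: I.
- apply: side_inv_sub (inv_fwd I) _ _ => x; first by rewrite live.
  by apply: disj; exact: (side_disjoint (inv_fwd I)).
- apply: side_inv_sub (inv_bwd I) _ _ => x; first by rewrite live.
  by apply: disj; exact: (side_disjoint (inv_bwd I)).
- move=> x; case: ifP => [su|_]; last exact: inv_FP.
  by rewrite in_setU1 => /predU1P[->//|]; apply: inv_FP.
- move=> x; case: ifP => [su|_]; last exact: inv_BP.
  by rewrite in_setU1 => /predU1P[->//|]; apply: inv_BP.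
- by move=> x y xF yB xo yo; rewrite !live //; apply: inv_sep.
Qed.

(** With [FA] empty, every open forward vertex not yet discarded is passive and lies after the old
    threshold. The backward vertices being discarded are the threshold itself and those of [BP],
    which lie before it, so [inv_sep] survives. *)
Lemma inv_refill_forward st st' : inv st -> refill_forward ord st st' -> inv st'.
Proof.
move=> I; case=> [//|A0 P0|s A0 sP].
- split=> /=; try by case: I.
  + apply: side_inv_sub (inv_bwd I) _ _ => x; rewrite in_set0 ?orbF //.
    by rewrite in_setD1 => /andP[_ ->].
  + by move=> y; rewrite in_set0.
  + move=> x y xF yB xo yo; case: (inv_sep I xF yB xo yo); first by left.
    by rewrite A0 P0 !in_set0.
- split=> /=; try by case: I.
  + apply: side_inv_sub (inv_fwd I) _ _ => x; rewrite !inE.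
      by case/orP=> /andP[->]; rewrite orbT.
    by case/andP=> _ /negPf->; rewrite andbF.
  + apply: side_inv_sub (inv_bwd I) _ _ => x; rewrite in_set0 ?orbF //.
    by rewrite in_setD1 => /andP[_ ->].
  + by move=> x; rewrite inE => /andP[].
  + by move=> y; rewrite in_set0.
  + move=> x y xF yB xo yo; case: (inv_sep I xF yB xo yo); first by left.
    rewrite A0 !in_set0 orbF /= => /andP[xP yL].
    rewrite !inE xP /= orNb /=.
    have lt_x := inv_FP I xP.
    have [->|_] := eqVneq y (thr st); first by left.
    case/orP: yL => [->|/(inv_BP I) lt_y]; first by right.
    by left; apply: before_trans lt_y lt_x.
Qed.

Lemma inv_refill_backward st st' : inv st -> refill_backward ord st st' -> inv st'.
Proof.
move=> I; case=> [//|A0 P0|s A0 sP].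
- split=> /=; try by case: I.
  + apply: side_inv_sub (inv_fwd I) _ _ => x; rewrite in_set0 ?orbF //.
    by rewrite in_setD1 => /andP[_ ->].
  + by move=> y; rewrite in_set0.
  + move=> x y xF yB xo yo; case: (inv_sep I xF yB xo yo); first by left.
    by rewrite A0 P0 !in_set0 andbF.
- split=> /=; try by case: I.
  + apply: side_inv_sub (inv_fwd I) _ _ => x; rewrite in_set0 ?orbF //.
    by rewrite in_setD1 => /andP[_ ->].
  + apply: side_inv_sub (inv_bwd I) _ _ => x; rewrite !inE.
      by case/orP=> /andP[->]; rewrite orbT.
    by case/andP=> _ /negPf->; rewrite andbF.
  + by move=> y; rewrite in_set0.
  + by move=> x; rewrite inE => /andP[].
  + move=> x y xF yB xo yo; case: (inv_sep I xF yB xo yo); first by left.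
    rewrite A0 !in_set0 orbF /= => /andP[xL yP].
    rewrite !inE yP /= orNb andbT.
    have lt_y := inv_BP I yP.
    have [->|_] := eqVneq x (thr st); first by left.
    case/orP: xL => [->|/(inv_FP I) lt_x]; first by right.
    by left; apply: before_trans lt_y lt_x.
Qed.

Lemma inv_examine st u z st' : inv st -> u \in FA st -> z \in BA st ->
  examine outs ins ord st u z st' -> inv st'.
Proof.
by move=> I uA zA [_ h|_]; [apply: inv_search | apply: inv_pause].
Qed.

Lemma inv_reachable st : reachable outs ins ord v w st -> inv st.
Proof.
elim=> [|st0 st' _ I [u z st1 st2 st3 uA zA ex1 r2 r3]]; first exact: inv_init.
apply: inv_refill_backward r3; apply: inv_refill_forward r2.
exact: inv_examine ex1.
Qed.

(** * Correctness of the returned value *)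

Definition drained st :=
  (FA st = set0 -> FP st = set0) /\ (BA st = set0 -> BP st = set0).

(** The refills alone ensure this after each iteration: a new threshold [s] is itself made active,
    since [s] is not before [s]. *)
Lemma drained_reachable st : reachable outs ins ord v w st -> drained st.
Proof.
case=> [|st0 st' _ [u z st1 st2 st3 _ _ _ r2 r3]]; first by [].
have F2 : FA st2 = set0 -> FP st2 = set0.
  case: r2 => [/eqP//|//|s _ sP] /= /setP/(_ s).
  by rewrite !inE sP /before ltnn.
case: r3 F2 => [/eqP //|_ P0 //|s _ sP] F2; split=> //=.
by move=> /setP/(_ s); rewrite !inE sP /before ltnn.
Qed.

Definition separated st := forall x y, x \in sF st -> y \in sB st ->
  out st x != [::] -> inn st y != [::] -> lt y x.

Lemma returns_null_separated st : reachable outs ins ord v w st ->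
  returns ord st None -> separated st.
Proof.
move=> rch ret; have I := inv_reachable rch; have [dF dB] := drained_reachable rch.
move=> x y xF yB xo yo; case: (inv_sep I xF yB xo yo) => //.
have : FA st = set0 \/ BA st = set0 by inversion ret.
by case=> A0; [rewrite A0 dF | rewrite A0 dB]; rewrite ?in_set0 ?andbF.
Qed.

(** A vertex of [sB st] reachable from [x] is not before [x], so separation forbids it to be open.
    Going back along the path from [v], each vertex is thus exhausted in B, and so its predecessor
    is visited. *)
Lemma separated_backward st x z : inv st -> separated st ->
  x \in sF st -> out st x != [::] -> connect e x z -> connect e z v ->
  (z \in sB st) && (inn st z == [::]).
Proof.
move=> I sep xF xo xz /connectP[p].
have closed y : connect e x y -> y \in sB st -> inn st y = [::].
  move=> xy yB; apply/eqP; apply: contraTT (connect_le xy) => yo.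
  by have := sep _ _ xF yB xo yo; rewrite /before -ltnNge.
elim: p z xz => [|z' p IHp] z xz /= => [_ vz|/andP[zz' pz'] lastE].
  by have vB := inv_vB I; rewrite -vz in xz *; rewrite vB closed.
have xz' : connect e x z' by apply: connect_trans xz (connect1 zz').
have /andP[z'B /eqP z'0] := IHp z' xz' pz' lastE.
have zB : z \in sB st.
  have zz'I : (z, z') \in ins z' by rewrite mem_ins /= eqxx andbT.
  by case: (side_closed (inv_bwd I) z'B zz'I) => //; rewrite z'0.
by rewrite zB closed.
Qed.

(** Every vertex on a path from [w] to [v] would be in F and not exhausted in B: it cannot be open
    in F by [separated_backward], so its successor is in F, and by [inv_meet] that successor is not
    exhausted in B. But [v] is not in F. *)
Lemma separated_acyclic st : inv st -> separated st -> ~ connect e w v.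
Proof.
move=> I sep /connectP[p].
have : w \in sF st by apply: inv_wF.
have : ~~ ((w \in sB st) && (inn st w == [::])) by rewrite (negPf (inv_wB I)).
elim: p {1 2 3 4 5}w => [|q' p IHp] q qB qF /= => [_ vE|/andP[qq' pq'] lastE].
  by have := inv_vF I; rewrite vE qF.
have [q0|qo] := eqVneq (out st q) [::]; last first.
  case/negP: qB; apply: (separated_backward I sep qF qo (connect0 _ _)).
  by apply/connectP; exists (q' :: p) => //=; apply/andP.
apply: (IHp q') => //.
  apply/negP => /andP[q'B /eqP q'0].
  by case: (inv_meet I qq' qF q'B); rewrite ?q0 ?q'0.
have qq'O : (q, q') \in outs q by rewrite mem_outs /= eqxx andbT.
by case: (side_closed (inv_fwd I) qF qq'O) => //; rewrite q0.
Qed.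

Lemma returns_correct st r : reachable outs ins ord v w st -> returns ord st r ->
  (r <> None <-> has_cycle ((v, w) :: E)).
Proof.
move=> rch ret; have I := inv_reachable rch; rewrite cycle_connect.
split=> [|wv rN]; last first.
  rewrite rN in ret; exact: separated_acyclic I (returns_null_separated rch ret) wv.
case: ret => // u z a uA zA _ + _.
have [uF _ [_ uxE]] := out_arcP I uA; have [zB _ [_ yzE]] := in_arcP I zA.
rewrite /hit; case: ifP => [xB _|_].
  exact: connect_trans (connect_trans (inv_reachF I uF) (connect1 uxE)) (inv_reachB I xB).
case: ifP => // yF _.
exact: connect_trans (connect_trans (inv_reachF I yF) (connect1 yzE)) (inv_reachB I zB).
Qed.

(** * Termination *)

(** An unvisited vertex counts with its full list, so visiting it leaves the sum unchanged, and a
    search step lowers it by the outgoing arc that it consumes. *)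
Definition arcs_left st := \sum_x size (if x \in sF st then out st x else outs x).
Definition live st := #|FA st :|: FP st| + #|BA st :|: BP st|.
(* A new threshold is active, remains so until it is discarded by the next
   refill unless a search step intervenes, and discarding it decreases [live].
   So a refill decreases [live] or makes an inactive threshold active; the
   factor outweighs the effect of the refill on the active sets. *)
Definition phase st :=
  (thr st \notin FA st :|: BA st) * (2 * #|V| + 1) + (#|FA st| + #|BA st|).
(* Lexicographic in [arcs_left], [live] and [phase]. *)
Definition potential st :=
  (arcs_left st * (2 * #|V| + 1) + live st) * (4 * #|V| + 2) + phase st.

(** The bounds here and in [live_lt] are the multipliers in [potential], which makes its comparison
    lexicographic. *)
Lemma phase_lt st : phase st < 4 * #|V| + 2.
Proof.
have := max_card (FA st); have := max_card (BA st); rewrite /phase.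
case: (_ \notin _) => /=; clear; lia.
Qed.

Lemma live_lt st : live st < 2 * #|V| + 1.
Proof.
have := max_card (FA st :|: FP st); have := max_card (BA st :|: BP st).
by rewrite /live; clear; lia.
Qed.

Lemma lex_lt K a b a' b' : b < K -> a < a' -> a * K + b < a' * K + b'.
Proof.
move=> bK aa'; apply: (@leq_trans (a.+1 * K)); first by rewrite mulSn addnC ltn_add2r.
by rewrite (leq_trans _ (leq_addr _ _)) // leq_mul2r aa' orbT.
Qed.

Lemma potential_arcs st st' : arcs_left st' < arcs_left st ->
  potential st' < potential st.
Proof.
move=> h; apply: lex_lt (phase_lt _) _; exact: lex_lt (live_lt _) h.
Qed.

Lemma potential_le st st' : arcs_left st' <= arcs_left st ->
  live st' < live st \/ live st' <= live st /\ phase st' <= phase st ->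
  potential st' <= potential st.
Proof.
move=> ha [hl|[hl hp]].
  apply/ltnW/lex_lt; first exact: phase_lt.
  by rewrite -addnS leq_add // leq_mul2r ha orbT.
by rewrite leq_add // leq_mul2r leq_add ?orbT // leq_mul2r ha orbT.
Qed.

Lemma potential_lt st st' : arcs_left st' = arcs_left st ->
  live st' = live st -> phase st' < phase st -> potential st' < potential st.
Proof. by rewrite /potential => -> ->; rewrite ltn_add2l. Qed.

Lemma potential_refill_forward st st' :
  refill_forward ord st st' -> potential st' <= potential st.
Proof.
have cardBA : thr st \in BA st -> #|(BA st :\ thr st) :|: set0| < #|BA st :|: BP st|.
  move=> sB; apply: proper_card; apply/properP; split.
    by rewrite setU0; apply: subset_trans (subsetDl _ _) (subsetUl _ _).
  by exists (thr st); rewrite !inE ?sB ?eqxx.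
have subBA : thr st \notin BA st -> BA st :\ thr st = BA st.
  by move=> sB; apply/setP=> x; rewrite !inE; case: eqP => // ->; rewrite (negPf sB).
case=> // [A0 P0|s A0 sP].
- apply: potential_le => //; have [sB|sB] := boolP (thr st \in BA st).
    by left; rewrite /live /= ltn_add2l cardBA.
  right; rewrite /live /phase /= subBA //; split=> //.
  by rewrite leq_add2l subset_leq_card // setU0 subsetUl.
- have PE : [set x in FP st | ~~ lt s x] :|: [set x in FP st | lt s x] = FP st.
    by apply/setP=> x; rewrite !inE; case: (x \in FP st); case: (lt s x).
  apply: potential_le => //; have [sB|sB] := boolP (thr st \in BA st).
    by left; rewrite /live /= PE A0 set0U ltn_add2l cardBA.
  right; rewrite /live /= PE A0 set0U subBA // setU0; split.
    by rewrite leq_add2l subset_leq_card // subsetUl.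
  (* The old threshold was inactive and the new one is active: the [2 * #|V| + 1] thus freed pays
     for the at most [#|V|] vertices added to [FA]. *)
  rewrite /phase /= A0 !inE sP (negPf sB) /before ltnn /= mul1n mul0n add0n cards0 add0n.
  by rewrite leq_add2r (leq_trans (max_card _)) // mulSn -addnA leq_addr.
Qed.

Lemma potential_refill_backward st st' :
  refill_backward ord st st' -> potential st' <= potential st.
Proof.
have cardFA : thr st \in FA st -> #|(FA st :\ thr st) :|: set0| < #|FA st :|: FP st|.
  move=> sF; apply: proper_card; apply/properP; split.
    by rewrite setU0; apply: subset_trans (subsetDl _ _) (subsetUl _ _).
  by exists (thr st); rewrite !inE ?sF ?eqxx.
have subFA : thr st \notin FA st -> FA st :\ thr st = FA st.
  by move=> sF; apply/setP=> x; rewrite !inE; case: eqP => // ->; rewrite (negPf sF).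
case=> // [A0 P0|s A0 sP].
- apply: potential_le => //; have [sF|sF] := boolP (thr st \in FA st).
    by left; rewrite /live /= ltn_add2r cardFA.
  right; rewrite /live /phase /= subFA //; split=> //.
  by rewrite leq_add2r subset_leq_card // setU0 subsetUl.
- have PE : [set x in BP st | ~~ lt x s] :|: [set x in BP st | lt x s] = BP st.
    by apply/setP=> x; rewrite !inE; case: (x \in BP st); case: (lt x s).
  apply: potential_le => //; have [sF|sF] := boolP (thr st \in FA st).
    by left; rewrite /live /= PE A0 set0U ltn_add2r cardFA.
  right; rewrite /live /= PE A0 set0U subFA // setU0; split.
    by rewrite leq_add2r subset_leq_card // subsetUl.
  rewrite /phase /= A0 !inE sP (negPf sF) /before ltnn orbT /= mul1n mul0n add0n cards0 addn0.
  by rewrite [X in X <= _]addnC leq_add2r (leq_trans (max_card _)) // mulSn -addnA leq_addr.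
Qed.

Lemma potential_search st u z : inv st -> u \in FA st ->
  potential (search_step outs ins st u z) < potential st.
Proof.
move=> I uA; apply: potential_arcs; rewrite search_stepE /arcs_left /=.
have [uF uo _] := out_arcP I uA; set x := (out_arc st u).2.
rewrite (bigD1 u) //= [X in _ < X](bigD1 u) //= -addSn leq_add //.
  rewrite in_setU1 uF orbT next_ptrE; case: eqP => [<-|_] /=; rewrite ?uF eqxx /=;
  by rewrite size_behead; case: (out st u) uo.
apply: leq_sum => q /negPf qu; rewrite next_ptrE qu in_setU1.
by have [->|_] := eqVneq q x => /=; case: (_ \in sF st).
Qed.

Lemma live_pause st u z : u \in FA st -> z \in BA st ->
  live (pause ord st u z) = live st.
Proof.
move=> uA zA; rewrite /live /=; congr (_ + _).
  case: ifP => // _; congr #|pred_of_set _|; apply/setP=> x; rewrite !inE.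
  by have [->|] := eqVneq x u; rewrite ?uA.
case: ifP => // _; congr #|pred_of_set _|; apply/setP=> x; rewrite !inE.
by have [->|] := eqVneq x z; rewrite ?zA.
Qed.

(** The comparisons with the threshold are strict, so the threshold itself is never paused and the
    first term of [phase] stays, while an active set shrinks. *)
Lemma phase_pause st u z : u \in FA st -> z \in BA st ->
  lt (thr st) u || lt z (thr st) -> phase (pause ord st u z) < phase st.
Proof.
move=> uA zA suz; rewrite /phase /=.
have -> : (thr st \notin (if lt (thr st) u then FA st :\ u else FA st)
    :|: (if lt z (thr st) then BA st :\ z else BA st)) =
    (thr st \notin FA st :|: BA st).
  congr (~~ _); rewrite !in_setU; congr (_ || _).
    by case: ifP => // su; rewrite in_setD1; case: eqP su => // ->; rewrite /before ltnn.
  by case: ifP => // su; rewrite in_setD1; case: eqP su => // ->; rewrite /before ltnn.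
rewrite ltn_add2l; have := cardsD1 u (FA st); have := cardsD1 z (BA st).
rewrite uA zA; move: suz; case: (lt (thr st) u); case: (lt z (thr st)) => //= _; clear; lia.
Qed.

Lemma potential_examine st u z st' : inv st -> u \in FA st -> z \in BA st ->
  examine outs ins ord st u z st' ->
  potential st' < potential st \/ st' = st /\ u = z.
Proof.
move=> I uA zA [uz h|uz]; first by left; apply: potential_search.
have [suz|] := boolP (lt (thr st) u || lt z (thr st)).
  by left; apply: potential_lt; rewrite ?live_pause ?phase_pause.
(* If nothing moves, then [u <= s <= z <= u] for the threshold [s]. *)
rewrite negb_or => /andP[su sz]; right; split.
  by rewrite /pause (negPf su) (negPf sz); case: (st).
by apply: index_ord_inj; move: uz su sz; rewrite /before; clear; lia.
Qed.

Lemma potential_iteration st st' : inv st -> iteration outs ins ord st st' ->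
  potential st' < potential st \/
  st' = st /\ exists2 x, x \in FA st & x \in BA st.
Proof.
move=> I [u z st1 st2 st3 uA zA ex1 r2 r3].
case: (potential_examine I uA zA ex1) => [lt1|[st1E uz]].
  left; apply: leq_ltn_trans (potential_refill_backward r3) _.
  exact: leq_ltn_trans (potential_refill_forward r2) lt1.
right; split; last by exists u; rewrite // uz.
(* Both active sets are nonempty, so both refills are skips. *)
rewrite {}st1E in r2; case: r2 r3 => [_|A0|s A0]; try by rewrite A0 in_set0 in uA.
by case=> [//|A0|s A0]; rewrite A0 in_set0 in zA.
Qed.

(** From a state of least potential on, every iteration is without effect. It then has a vertex
    active on both sides, which lies on a path from [w] to [v]. *)
Lemma infinite_run_stable run : infinite_run outs ins ord v w run ->
  has_cycle ((v, w) :: E) /\ exists N, forall k, N <= k -> run k = run N.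
Proof.
case=> run0 runS.
have rch k : reachable outs ins ord v w (run k).
  elim: k => [|k IHk]; first by rewrite run0; constructor.
  exact: Reachable_iteration IHk (runS k).
(* Excluded middle decides whether an arbitrary run ever goes below a given bound. *)
have [N minN] : exists N, forall k, potential (run N) <= potential (run k).
  suff min m : forall k, potential (run k) <= m ->
      exists N, forall k, potential (run N) <= potential (run k).
    exact: (min _ 0 (leqnn _)).
  elim: m => [|m IHm] k km; first by exists k => j; apply: leq_trans km _.
  have [[j jm]|none] := classic (exists j, potential (run j) <= m).
    exact: IHm jm.
  exists k => j; apply: leq_trans km _; rewrite ltnNge; apply/negP => jm.
  by apply: none; exists j.
have stepN k : N <= k -> run k = run N.
  elim: k => [|k IHk]; first by rewrite leqn0 => /eqP->.
  rewrite leq_eqVlt ltnS => /predU1P[<- //|/IHk runk].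
  case: (potential_iteration (inv_reachable (rch k)) (runS k)) => [|[-> //]].
  by rewrite runk ltnNge minN.
split; last by exists N.
have I := inv_reachable (rch N).
case: (potential_iteration I (runS N)) => [|[_ [x xF xB]]].
  by rewrite ltnNge minN.
apply/cycle_connect.
have [xF' _ _] := out_arcP I xF; have [xB' _ _] := in_arcP I xB.
exact: connect_trans (inv_reachF I xF') (inv_reachB I xB').
Qed.

(** * The reordering step *)

Lemma uniq_ord : uniq ord.
Proof. by case: topE => /perm_uniq ->; rewrite enum_uniq. Qed.

(** The negated comparison admits [y = t], as the block goes just before [t]. *)
Lemma topological_insert_before E' t L : uniq L -> t \notin L ->
  (forall x y, (x, y) \in E' ->
    if x \in L then if y \in L then before L x y else ~~ lt y t
    else if y \in L then lt x t else lt x y) ->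
  topological_order E' (insert_before t L [seq x <- ord | x \notin L]).
Proof.
move=> uL tL arcs; apply: topological_insert => //; first exact: uniq_ord.
- exact: mem_ord.
- exact: index_size.
move=> x y /arcs; have [xL|xL] := boolP (x \in L);
  have [yL|yL] := boolP (y \in L) => //.
  by rewrite -(before_filter (p := fun x => x \notin L) ord) // /before -leqNgt.
by rewrite -(before_filter (p := fun x => x \notin L) ord).
Qed.

Lemma topological_insert_after E' t L : uniq L -> t \notin L ->
  (forall x y, (x, y) \in E' ->
    if x \in L then if y \in L then before L x y else lt t y
    else if y \in L then ~~ lt t x else lt x y) ->
  topological_order E' (insert_after t L [seq x <- ord | x \notin L]).
Proof.
move=> uL tL arcs; apply: topological_insert => //; first exact: uniq_ord.
- exact: mem_ord.
- by rewrite index_mem mem_filter tL mem_ord.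
move=> x y /arcs; have [xL|xL] := boolP (x \in L);
  have [yL|yL] := boolP (y \in L) => //.
  by rewrite -(before_filter (p := fun x => x \notin L) ord).
by rewrite -(before_filter (p := fun x => x \notin L) ord) // /before -leqNgt.
Qed.

Lemma reorder_pivotP st (t := reorder_pivot ord v st) :
  (t = v \/ t \in sF st /\ out st t != [::]) /\
  forall x, x = v \/ x \in sF st /\ out st x != [::] -> ~~ lt x t.
Proof.
pose p x := (x == v) || (x \in sF st) && (out st x != [::]).
have pP x : reflect (x = v \/ x \in sF st /\ out st x != [::]) (p x).
  by apply: (iffP predU1P) => -[->|/andP]; auto.
have pt : p t.
  rewrite /t /reorder_pivot -/p; case E0: (filter _ _) => [|a l] /=; first exact/pP/or_introl.
  have : a \in [seq x <- ord | p x] by rewrite E0 mem_head.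
  by rewrite mem_filter => /andP[].
split=> [|x /pP px]; first exact/pP.
rewrite -(before_filter ord px pt) /before -leqNgt.
(* As [v] itself qualifies, the list is nonempty, and its head has index 0. *)
have : v \in [seq x <- ord | p x] by rewrite mem_filter mem_ord /p eqxx.
by rewrite /t /reorder_pivot -/p; case: (filter _ _) => //= a l _; rewrite eqxx.
Qed.

Lemma ltNge x y : x <> y -> ~~ lt x y -> lt y x.
Proof.
rewrite /before -leqNgt leq_eqVlt => xy /predU1P[/esym/index_ord_inj //|//].
Qed.

Lemma reorder_topological st ord' : reachable outs ins ord v w st ->
  returns ord st None -> reorder E ord v st ord' ->
  topological_order ((v, w) :: E) ord'.
Proof.
move=> rch ret; have I := inv_reachable rch.
have sep := returns_null_separated rch ret; have nwv := separated_acyclic I sep.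
have disj x : x \in sF st -> x \in sB st -> False.
  move=> /(inv_reachF I) wx /(inv_reachB I) xv.
  exact: nwv (connect_trans wx xv).
have arcFB x y : (x, y) \in E -> x \in sF st -> y \in sB st -> False.
  move=> xy /(inv_reachF I) wx /(inv_reachB I) yv.
  exact: nwv (connect_trans (connect_trans wx (connect1 xy)) yv).
have [] := reorder_pivotP st.
set t := reorder_pivot ord v st => tP tmin.
have FbP x : (x \in F_below ord v st) = (x \in sF st) && lt x t by rewrite inE.
have BaP x : (x \in B_above ord v st) = (x \in sB st) && lt t x by rewrite inE.
(* By minimality of the pivot, a forward vertex below it is exhausted, so its successors are
   visited. *)
have Fb_arc x y : x \in F_below ord v st -> (x, y) \in E -> y \in sF st.
  rewrite FbP => /andP[xF xt] xy.
  have x0 : out st x = [::].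
    by apply/eqP/negPn/negP => xo; case/negP: (tmin x (or_intror (conj xF xo))).
  have xyO : (x, y) \in outs x by rewrite mem_outs xy eqxx.
  by case: (side_closed (inv_fwd I) xF xyO) => //; rewrite x0.
case=> [LF tv [pLF topLF]|LF LB tv [pLF topLF] [pLB topLB]].
- have mLF x : (x \in LF) = (x \in F_below ord v st).
    by rewrite (perm_mem pLF) mem_enum.
  rewrite (eq_filter (a2 := fun x => x \notin LF)); last by move=> x; rewrite mLF.
  rewrite -/t in tv *; apply: topological_insert_after.
  + by rewrite (perm_uniq pLF) enum_uniq.
  + by rewrite mLF FbP /before ltnn andbF.
  move=> x y; rewrite inE !mLF => /predU1P[[-> ->]|xy].
    rewrite !FbP tv (negPf (inv_vF I)) (inv_wF I) lt_wv /=.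
    by rewrite /before ltnn.
  case: ifP => xL; case: ifP => yL.
  + exact: topLF.
  (* Here [y] is in F and not before [t = v]; since [v] is not in F, [y] comes after it. *)
  + have yF := Fb_arc _ _ xL xy; apply: ltNge; last by move: yL; rewrite FbP yF /= => ->.
    by move=> yt; have := inv_vF I; rewrite -tv -yt yF.
  + move: yL; rewrite FbP => /andP[_ yt].
    by rewrite /before -leqNgt; apply/ltnW/(before_trans (arc_lt xy) yt).
  + exact: arc_lt.
- rewrite -/t in tv *.
  have [//|[tF to]] := tP.
  have tv' : lt t v by apply: ltNge; [apply/nesym | apply: tmin; left].
  have mLF x : (x \in LF) = (x \in F_below ord v st).
    by rewrite (perm_mem pLF) mem_enum.
  have mLB x : (x \in LB) = (x \in B_above ord v st).
    by rewrite (perm_mem pLB) mem_enum.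
  have FbBa x : x \in F_below ord v st -> x \notin B_above ord v st.
    by rewrite FbP BaP negb_and /before -leqNgt => /andP[_ /ltnW->]; rewrite orbT.
  rewrite (eq_filter (a2 := fun x => x \notin LB ++ LF)); last first.
    by move=> x; rewrite mem_cat mLB mLF negb_or andbC.
  apply: topological_insert_before.
  + rewrite cat_uniq (perm_uniq pLF) (perm_uniq pLB) !enum_uniq andbT /=.
    by apply/hasPn=> x; rewrite mLF mLB => /FbBa.
  + by rewrite mem_cat mLB mLF FbP BaP /before ltnn !andbF.
  move=> x y; rewrite inE !mem_cat !mLB !mLF => /predU1P[[-> ->]|xy].
    (* The new arc starts in [LB], and [w] is in [LF] or stays at or after the pivot. *)
    have vBa : v \in B_above ord v st by rewrite BaP (inv_vB I).
    have wBa : w \notin B_above ord v st.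
      rewrite BaP negb_and; apply/orP; left; exact: inv_wB I.
    rewrite vBa (negPf wBa) /= before_cat_lr ?mLB // FbP (inv_wF I) /=.
    by case: (lt w t).
  have [xFb|xFb] := boolP (x \in F_below ord v st).
    have yF := Fb_arc _ _ xFb xy.
    have yBa : y \notin B_above ord v st.
      by apply/negP; rewrite BaP => /andP[/(disj _ yF)].
    rewrite orbT (negPf yBa) /=; case: ifP => [yFb|]; last by rewrite FbP yF /= => ->.
    by rewrite before_cat_r ?mLB ?FbBa //; apply: topLF.
  rewrite orbF; have [xBa|xBa] := boolP (x \in B_above ord v st).
    have ty : lt t y.
      by move: xBa; rewrite BaP => /andP[_ tx]; apply: before_trans tx (arc_lt xy).
    have yt : ~~ lt y t by rewrite /before -leqNgt ltnW.
    rewrite FbP (negPf yt) andbF orbF; case: ifP => // yBa.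
    by rewrite before_cat_l ?mLB //; apply: topLB.
  case: ifP => [/orP[yBa|]|_]; last exact: arc_lt.
  (* The pivot is open in F, so by separation [y], which comes after it, is exhausted in B. Hence
     [x] is in B, and being outside [B_above] and distinct from the pivot it comes before it. *)
  + move: (yBa); rewrite BaP => /andP[yB ty].
    have y0 : inn st y = [::].
      apply/eqP/negPn/negP => yo; have := sep _ _ tF yB to yo.
      by move: ty; rewrite /before ltnNge => /negbTE tly /ltnW; rewrite tly.
    have xyI : (x, y) \in ins y by rewrite mem_ins xy eqxx.
    have xB : x \in sB st.
      by case: (side_closed (inv_bwd I) yB xyI) => //; rewrite y0.
    apply: ltNge => [tx|]; first by apply: (disj x) => //; rewrite -tx.
    by move: xBa; rewrite BaP xB.
  + by rewrite FbP => /andP[_ yt]; apply: before_trans (arc_lt xy) yt.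
Qed.

End Correctness.

Theorem theorem4p4 (V : finType) (E : seq (V * V))
    (outs ins : V -> seq (V * V)) (ord : seq V) (v w : V) :
  ~ has_cycle E ->
  topological_order E ord ->
  incidence_lists E outs ins ->
  before ord w v ->
  [/\ (* whatever the choices, what the search returns is correct *)
      forall (st : state V) (r : option (V * V)),
        reachable outs ins ord v w st -> returns ord st r ->
        (r <> None <-> has_cycle ((v, w) :: E)),
      (* a run that does not return repeats forever an iteration without
         effect, which is only possible if a cycle is created *)
      forall run : nat -> state V, infinite_run outs ins ord v w run ->
        has_cycle ((v, w) :: E) /\
        exists N, forall k, N <= k -> run k = run N
    & (* after null, every outcome of the reordering is topological *)
      forall (st : state V) (ord' : seq V),
        reachable outs ins ord v w st -> returns ord st None ->
        reorder E ord v st ord' ->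
        topological_order ((v, w) :: E) ord'].
Proof.
move=> _ topE incE lt_wv; split=> [st r|run|st ord'].
- exact: returns_correct.
- exact: infinite_run_stable.
- exact: reorder_topological.
Qed.
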